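(* Let $R$ be a ring with identity and let $U$ be a non-zero artinian uniserial right $R$-module with endomorphism ring $S=\mathrm{End}(U_R)$, and let $0=U_0<U_1<\dots<U_\alpha=U$ be the chain of all submodules of $U$. Let $\kappa(S)$ be the submonoid of $\alpha+1$ associated to $S$, so that $\kappa(S)\cong\vartheta+1$ as an ordered set for some ordinal $\vartheta\le\alpha$. Then $U$ is not self-small if and only if $\kappa(S\setminus\{0\})$ is cofinal in $\alpha$ and $\mathrm{cf}(\vartheta)=\aleph_0$.
   Context: A module is uniserial if its lattice of submodules is linearly ordered by inclusion; for an artinian uniserial module $U$ the submodules form a well-ordered chain $0=U_0<U_1<\dots<U_\alpha=U$ indexed by the ordinals $\le\alpha$. The map $\kappa\colon S\to\alpha+1$ sends $f\in S$ to the ordinal $\gamma\le\alpha$ with $\ker f=U_\gamma$. The set $\alpha+1$ of ordinals $\le\alpha$ is a monoid under $\gamma\oplus\delta:=\min\{\gamma+\delta,\alpha\}$; $\kappa$ is a monoid antihomomorphism from the multiplicative monoid of $S$, and $\kappa(S)$ is its image, a submonoid containing $\alpha=\kappa(0)$. $\mathrm{cf}$ denotes cofinality (with $\mathrm{cf}=1$ for successor ordinals). A module $N_R$ is self-small if for every set $X$ and every homomorphism $\varphi\colon N\to N^{(X)}$ there exists a finite subset $F\subseteq X$ with $\varphi(N)\subseteq N^{(F)}$. *)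

(* Defs.v *)
From HB Require Import structures.
From mathcomp Require Import all_boot all_order all_algebra.
From mathcomp Require Import boolp classical_sets functions cardinality.

Set Implicit Arguments.
Unset Strict Implicit.
Unset Printing Implicit Defensive.

Import Order.TTheory GRing.Theory.
Local Open Scope classical_set_scope.
Local Open Scope ring_scope.

(* A right R-module is a left module over the converse ring R^c. *)
Notation rmodType R := (lmodType R^c).

Definition submodule (R : pzRingType) (M : lmodType R) (N : set M) : Prop :=
  submod_closed (mem N).

Definition uniserial (R : pzRingType) (M : lmodType R) : Prop :=
  forall N N' : set M, submodule N -> submodule N' ->
    N `<=` N' \/ N' `<=` N.

Definition artinian (R : pzRingType) (M : lmodType R) : Prop :=
  forall N : nat -> set M, (forall n, submodule (N n)) ->
    (forall n, N n.+1 `<=` N n) ->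
    exists n, forall m, (n <= m)%N -> N m = N n.

Definition kernel (R : pzRingType) (M M' : lmodType R)
    (f : {linear M -> M'}) : set M := [set x | f x = 0].

(* The direct sum M^(X): the module of finitely supported functions X -> M. *)
Section DirectSum.
Context (R : pzRingType) (M : lmodType R) (X : Type).

Definition fin_supp : pred (X -> M) := fun g => `[< finite_set [set x | g x <> 0] >].

Lemma fin_supp_closed : subsemimod_closed fin_supp.
Proof.
split; first split.
- apply/asboolP; rewrite (_ : [set x | _] = set0) //.
  by apply/seteqP; split => x //= /(_ erefl).
- move=> g h /asboolP fg /asboolP fh; apply/asboolP.
  apply: (@sub_finite_set _ _ ([set x | g x <> 0] `|` [set x | h x <> 0])).
    move=> x /= gh; apply: contrapT => /not_orP [/contrapT g0 /contrapT h0].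
    by apply: gh; have -> : (g + h) x = g x + h x :> M by []; rewrite g0 h0 addr0.
  by rewrite finite_setU.
- move=> a g /asboolP fg; apply/asboolP.
  apply: sub_finite_set fg => x /= ag g0; apply: ag.
  by have -> : (a *: g) x = a *: g x :> M by []; rewrite g0 scaler0.
Qed.

Record direct_sum := DirectSum {
  component :> X -> M;
  component_fin_supp : fin_supp component }.

HB.instance Definition _ := [isSub for component].
HB.instance Definition _ := [Choice of direct_sum by <:].
HB.instance Definition _ :=
  GRing.SubChoice_isSubLmodule.Build R (X -> M)%type fin_supp direct_sum fin_supp_closed.

End DirectSum.

(* The inclusion phi(M) in M^(F) says that components outside F vanish. *)
Definition self_small (R : pzRingType) (M : lmodType R) : Prop :=
  forall (X : Type) (phi : {linear M -> direct_sum M X}),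
    exists2 F : set X, finite_set F &
      forall (m : M) (x : X), ~ F x -> phi m x = 0.

(* Ordinals.  The ordered set alpha+1 of all ordinals <= alpha is given as a
   well-ordered set A with least element \bot = 0 and greatest element
   \top = alpha.  An ordinal gamma <= alpha is thus an element of A, and the
   ordered sets gamma and gamma+1 are the following initial segments of A. *)

Definition well_ordered d (A : orderType d) : Prop :=
  well_founded (fun x y : A => (x < y)%O).

Definition ordset d (A : orderType d) (g : A) : set A := [set x | (x < g)%O].

Definition ordset_succ d (A : orderType d) (g : A) : set A :=
  [set x | (x <= g)%O].

Definition order_isomorphic d (A : orderType d) d' (B : orderType d')
    (Y : set A) (Z : set B) : Prop :=
  exists2 h : A -> B, set_bij Y Z h &
    forall x y, Y x -> Y y -> (h x <= h y)%O = (x <= y)%O.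

Definition cofinal d (A : orderType d) (Z Y : set A) : Prop :=
  Z `<=` Y /\ forall y, Y y -> exists2 z, Z z & (y <= z)%O.

(* The least cardinality of a cofinal subset of Y is that of K.  A set with a
   greatest element has the cofinality of a singleton, so cf = 1 for successor
   ordinals. *)
Definition has_cofinality d (A : orderType d) (Y : set A)
    (I : Type) (K : set I) : Prop :=
  (exists2 Z, cofinal Z Y & (Z #= K)%card) /\
  (forall Z, cofinal Z Y -> (K #<= Z)%card).

(* (C g) for g in A is the chain 0 = U_0 < U_1 < ... < U_alpha = U of all
   submodules of U. *)
Record submodule_chain (R : pzRingType) (U : lmodType R)
    d (A : tbOrderType d) (C : A -> set U) : Prop := {
  chain_bot : C \bot%O = [set 0];
  chain_top : C \top%O = setT;
  chain_lt : forall g h : A, (g < h)%O -> C g `<` C h;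
  chain_submodule : forall g : A, submodule (C g);
  chain_all : forall N : set U, submodule N -> exists g : A, C g = N }.

(* Main.v *)
From HB Require Import structures.
Require Import Defs.
From mathcomp Require Import all_boot all_order all_algebra.
From mathcomp Require Import boolp classical_sets functions cardinality.
Set Implicit Arguments.
Unset Strict Implicit.
Unset Printing Implicit Defensive.
Import Order.TTheory GRing.Theory.
Local Open Scope classical_set_scope.
Local Open Scope ring_scope.

(** An element of U^(X) has finite support, so a homomorphism U -> U^(X) is a
   family of endomorphisms of which each u in U is killed by all but finitely
   many. Its image lies in some U^(F) with F finite exactly when only finitely
   many members are non-zero. Thus U fails to be self-small iff there is a
   sequence f_0, f_1, ... of non-zero endomorphisms such that each u in U is
   killed by f_n for all large n ([not_self_smallP]).

   Along the chain of submodules this says something about kernels alone. For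
   gamma < alpha pick u outside U_gamma: as soon as f_n u = 0, the kernel of f_n
   is not inside U_gamma, so kappa (f_n) > gamma. Conversely, if the
   kappa (f_n) < alpha eventually exceed each gamma < alpha, then alpha is a
   limit, U is the union of the U_gamma with gamma < alpha, and each u lies in
   the kernel of f_n for all large n ([exhausts_kappa]). So U is not self-small
   iff some sequence in kappa (S \ {0}) eventually exceeds each element of
   [0, alpha). Such a sequence exists iff kappa (S \ {0}) is cofinal in
   [0, alpha) and some sequence eventually exceeds each of its elements
   ([exhausts_cofinal]).

   The last condition is an order invariant, and it is cofinality aleph_0: the
   running maxima of an enumeration of a countable cofinal subset form such a
   sequence, and the range of such a sequence is a countable cofinal subset of
   an ordered set without a maximum, in which no finite set is cofinal
   ([has_cofinality_natP]). Since kappa (S \ {0}) is kappa (S) without its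
   maximum alpha = kappa 0, it is isomorphic to theta, which is theta + 1
   without its maximum ([iso_remove_top]). *)

(** * Cofinality aleph_0 *)

Lemma infinite_set_inj T (A : set T) :
  infinite_set A -> exists2 f : nat -> T, (forall n, A (f n)) & injective f.
Proof.
elim/Ppointed: T => T in A *; first by rewrite emptyE => /(_ (finite_set0 _)).
move=> /infiniteP/pcard_leP[f]; exists f => [n|m n fmn]; first exact: funS.
by apply: (@inj _ _ _ f) fmn; rewrite inE.
Qed.

Lemma card_nat_range T (Z : set T) :
  (Z #= [set: nat])%card -> exists z : nat -> T, Z = range z.
Proof.
move=> /pcard_eqP[f].
have /choice[z zf] n : exists x, Z x /\ f x = n.
  by have [x Zx <-] := @surj _ _ Z setT f n I; exists x.
exists z; apply/seteqP; split=> [x Zx|_ [n _ <-]]; last by case: (zf n).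
exists (f x) => //; have [Zzx fzx] := zf (f x).
by apply: (@inj _ _ Z f) fzx; rewrite inE.
Qed.

(** Eventual strict domination is stronger than having a cofinal range: it rules
   out a maximum of [Y], and for kernels it says that each element is killed by
   all but finitely many terms, not merely by infinitely many. *)
Definition exhausts d (A : orderType d) (Y : set A) (z : nat -> A) : Prop :=
  (forall n, Y (z n)) /\
  forall y, Y y -> exists N, forall n, (N <= n)%N -> (y < z n)%O.

Lemma running_max d (A : orderType d) (z : nat -> A) n :
  exists m, forall k, (k <= n)%N -> (z k <= z m)%O.
Proof.
elim: n => [|n [m zm]]; first by exists 0%N => k; rewrite leqn0 => /eqP->.
have [le_m|lt_m] := leP (z n.+1) (z m).
  by exists m => k; rewrite leq_eqVlt ltnS => /predU1P[->//|/zm].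
exists n.+1 => k; rewrite leq_eqVlt ltnS => /predU1P[->//|/zm le_k].
exact: le_trans le_k (ltW lt_m).
Qed.

Lemma finite_has_max d (A : orderType d) (Z : set A) (y : A) :
  finite_set Z -> Z y -> exists2 z, Z z & forall x, Z x -> (x <= z)%O.
Proof.
move=> /finite_seqP[s ->] /= ys; clear Z.
elim: s y ys => // a s IH y _; have [s0|[b bs]] : s = [::] \/ exists b, b \in s.
- by case: s {IH} => [|b s]; [left|right; exists b; rewrite mem_head].
- by exists a; rewrite s0 /= ?mem_head // => x; rewrite inE => /eqP->.
- have [z /= zs zmax] := IH b bs; have [le_az|lt_za] := leP a z.
  + by exists z => /= [|x]; rewrite inE ?zs ?orbT // => /predU1P[->//|/zmax].
  + exists a => /= [|x]; rewrite inE ?eqxx // => /predU1P[->//|/zmax le_xz].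
    exact: le_trans le_xz (ltW lt_za).
Qed.

(** Cofinality aleph_0 forbids a maximum, since a maximum alone would be a
   finite cofinal set; hence running maxima of a countable cofinal set get
   strictly above everything. Conversely a finite cofinal set would have a
   largest element, which the sequence exceeds. *)
Lemma has_cofinality_natP d (A : orderType d) (Y : set A) :
  has_cofinality Y [set: nat] <-> exists z, exhausts Y z.
Proof.
split=> [[[Z [ZY Zcof] /card_nat_range[z Zz]] Ymin]|[z [zY zlim]]].
- have no_max y : Y y -> exists2 y', Y y' & (y < y')%O.
    move=> Yy; apply: contrapT => y_max.
    suff /Ymin/infiniteP[] : cofinal [set y] Y by exact: finite_set1.
    split=> [_ -> //|y' Yy']; exists y => //.
    by rewrite leNgt; apply/negP => lt_yy'; apply: y_max; exists y'.
  have /choice[m mmax] := running_max z.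
  exists (z \o m); split=> [n|y /no_max[y' /Zcof[x]]] /=.
    by apply: ZY; rewrite Zz; exists (m n).
  rewrite Zz => -[N _ <-] le_y' lt_y; exists N => n leNn.
  exact: lt_le_trans lt_y (le_trans le_y' (mmax n N leNn)).
- have infinite_cofinal Z : cofinal Z Y -> ~ finite_set Z.
    move=> [ZY Zcof] Zfin; have [x Zx _] := Zcof _ (zY 0%N).
    have [m /ZY/zlim[N zN] mmax] := finite_has_max Zfin Zx.
    have [x' /mmax lex lez] := Zcof _ (zY N).
    by have := zN N (leqnn N); rewrite ltNge (le_trans lez lex).
  split=> [|Z /infinite_cofinal/infiniteP //].
  have zcof : cofinal (range z) Y.
    split=> [_ [n _ <-] //|y /zlim[N zN]]; exists (z N); first by exists N.
    exact/ltW/zN.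
  exists (range z) => //; apply: eq_card_nat (infinite_cofinal _ zcof).
  exact: card_le_trans (card_image_le _ _) (countableP _).
Qed.

(** Splits a sequence of elements of [K] that climbs through [Y] into the two
   conditions of the theorem, the second of which depends only on the order
   type of [K]. *)
Lemma exhausts_cofinal d (A : orderType d) (K Y : set A) (z : nat -> A) :
  K `<=` Y -> (forall n, K (z n)) ->
  exhausts Y z <-> cofinal K Y /\ exhausts K z.
Proof.
move=> KY zK; split=> [[zY zlim]|[[_ Kcof] [_ zlim]]].
  split; split=> // y; last by move/KY/zlim.
  by move=> /zlim[N zN]; exists (z N) => //; apply/ltW/zN.
split=> [n|y /Kcof[x /zlim[N zN] le_yx]]; first exact: KY.
by exists N => n /zN; apply: le_lt_trans.
Qed.

Lemma exhausts_iso d (A : orderType d) d' (B : orderType d')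
    (Y : set A) (Z : set B) :
  order_isomorphic Y Z ->
  (exists y, exhausts Y y) <-> (exists z, exhausts Z z).
Proof.
move=> [h [hYZ hinj hsurj] hle].
have hlt x y : Y x -> Y y -> (h x < h y)%O = (x < y)%O.
  by move=> Yx Yy; rewrite !ltNge hle.
split=> [[y [yY ylim]]|[z [zZ zlim]]].
  exists (h \o y); split=> [n|_ /hsurj[x Yx <-]]; first exact/hYZ/yY.
  by have [N yN] := ylim x Yx; exists N => n /yN; rewrite /= hlt.
have /choice[y yz] n : exists x, Y x /\ h x = z n.
  by have [x Yx hx] := hsurj _ (zZ n); exists x.
exists y; split=> [n|x Yx]; first by case: (yz n).
have [N zN] := zlim _ (hYZ _ Yx); exists N => n /zN.
by have [Yy <-] := yz n; rewrite hlt.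
Qed.

(** An order isomorphism matches greatest elements, so it restricts to the
   complements of these. *)
Lemma iso_remove_top d (A : orderType d) d' (B : orderType d')
    (Y : set A) (t : A) (s : B) :
  Y t -> (forall y, Y y -> (y <= t)%O) ->
  order_isomorphic Y (ordset_succ s) ->
  order_isomorphic (Y `&` ordset t) (ordset s).
Proof.
move=> Yt tmax [h [hY hinj hsurj] hle].
have ht : h t = s.
  apply: le_anti; have /= -> := hY t Yt; have [x Yx <-] := hsurj s (lexx s).
  by rewrite hle // tmax.
have hlt x y : Y x -> Y y -> (h x < h y)%O = (x < y)%O.
  by move=> Yx Yy; rewrite !ltNge hle.
exists h; last by move=> x y [Yx _] [Yy _]; exact: hle.
split=> [x [Yx xt]|x y|b /= bs].
- by rewrite /ordset /= -ht hlt.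
- by rewrite !inE => -[Yx _] [Yy _]; apply: hinj; rewrite inE.
- have [x Yx hx] := hsurj b (ltW bs); exists x => //; split=> //=.
  by rewrite /ordset /= -hlt // hx ht.
Qed.

(** * Homomorphisms into a direct sum of copies *)

Section Modules.
Context (R : pzRingType) (M : lmodType R).

Section Coordinate.
Context (X : Type) (phi : {linear M -> direct_sum M X}) (x : X).

Definition coordinate (u : M) : M := phi u x.

Lemma coordinate_is_linear : linear coordinate.
Proof. by move=> a u v; rewrite /coordinate linearP. Qed.

HB.instance Definition _ :=
  GRing.isLinear.Build R M M *:%R coordinate coordinate_is_linear.
End Coordinate.

Section Assemble.
Context (f : nat -> {linear M -> M}).
Context (fsmall : forall u, exists N, forall n, (N <= n)%N -> f n u = 0).

Lemma assemble_fin_supp u : fin_supp (fun n => f n u).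
Proof.
apply/asboolP; have [N fN] := fsmall u.
apply: sub_finite_set (finite_II N) => n /= fnu.
by rewrite ltnNge; apply/negP => /fN.
Qed.

Definition assemble (u : M) : direct_sum M nat :=
  DirectSum (assemble_fin_supp u).

Lemma assemble_is_linear : linear assemble.
Proof.
by move=> a u v; apply: val_inj; apply/funext => n; rewrite /= linearP.
Qed.

HB.instance Definition _ :=
  GRing.isLinear.Build R M (direct_sum M nat) *:%R assemble assemble_is_linear.
End Assemble.

(** A countable index set suffices: of a homomorphism into M^(X) with infinitely
   many non-zero coordinates keep those along an injection nat -> X, which
   preserves the finiteness of the support of each image. *)
Lemma not_self_smallP : ~ self_small M <->
  exists f : nat -> {linear M -> M},
    (forall n, exists u, f n u <> 0) /\
    (forall u, exists N, forall n, (N <= n)%N -> f n u = 0).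
Proof.
split=> [nsmall|[f [fn0 fsmall]] small].
- have [X [phi phi_inf]] : exists X (phi : {linear M -> direct_sum M X}),
      infinite_set [set x | exists m, phi m x <> 0].
    apply: contrapT => nphi; apply: nsmall => X phi.
    exists [set x | exists m, phi m x <> 0].
      by apply: contrapT => phi_inf; apply: nphi; exists X, phi.
    by move=> m x /= nx; apply: contrapT => mx; apply: nx; exists m.
  have [x xn0 xinj] := infinite_set_inj phi_inf.
  exists (fun n => coordinate phi (x n)); split=> [//|u].
  have xu_fin : finite_set [set n | phi u (x n) <> 0].
    have /asboolP := component_fin_supp (phi u); apply: finite_preimage.
    by move=> m n _ _; apply: xinj.
  (* Adding 0 to the support makes it non-empty, so that it has a maximum. *)
  have [N _ Nmax] : exists2 N, ([set n | phi u (x n) <> 0] `|` [set 0%N]) N &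
      forall n, ([set n | phi u (x n) <> 0] `|` [set 0%N]) n -> (n <= N)%N.
    by apply: (@finite_has_max _ nat _ 0%N); [rewrite finite_setU|right].
  exists N.+1 => n; apply: contraPP => nz; apply/negP; rewrite -ltnNge ltnS.
  by apply: Nmax; left.
- have [F Ffin FP] := small nat (assemble fsmall).
  apply: infinite_nat; apply: sub_finite_set Ffin => n _.
  by apply: contrapT => nFn; have [u] := fn0 n; apply; exact: (FP u n nFn).
Qed.
End Modules.

(** * Kernels along the chain of submodules *)

Section Chain.
Context (R : pzRingType) (U : lmodType R).
Context (d : Order.disp_t) (A : tbOrderType d) (C : A -> set U).
Context (C_chain : submodule_chain C).

Lemma chain_le g h : (g <= h)%O -> C g `<=` C h.
Proof.
by rewrite le_eqVlt => /predU1P[->|/(chain_lt C_chain)/properW].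
Qed.

Lemma chain_inj : injective C.
Proof.
by move=> g h Cgh; case: (ltgtP g h) => // /(chain_lt C_chain);
  rewrite Cgh => -[_ []].
Qed.

(** The union of the proper members of the chain is again a submodule, hence a
   member [C g]; if [g] were below the top, a larger proper member would
   contradict its being the union. *)
Lemma chain_limit :
  (\bot < \top :> A)%O ->
  (forall g : A, (g < \top)%O -> exists2 h, (g < h)%O & (h < \top)%O) ->
  forall u : U, exists2 g, (g < \top)%O & C g u.
Proof.
move=> lt_bt limit; pose N := [set u | exists2 g, (g < \top)%O & C g u].
have N_sub : submodule N.
  split=> [|a u v]; rewrite !inE.
    by exists \bot%O => //; rewrite (chain_bot C_chain).
  move=> [g g_top Cgu] [h h_top Chv]; exists (Order.max g h).
    by rewrite gt_max g_top.
  have [_ /(_ a u v)] := chain_submodule C_chain (Order.max g h).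
  have Cg_max : C g `<=` C (Order.max g h) by apply: chain_le; rewrite le_max lexx.
  have Ch_max : C h `<=` C (Order.max g h).
    by apply: chain_le; rewrite le_max lexx orbT.
  by rewrite !inE; apply; [exact: Cg_max|exact: Ch_max].
have [g CgN] := chain_all C_chain N_sub.
have g_top : g = \top%O.
  apply/eqP; rewrite -le1x leNgt; apply/negP => /limit[h lt_gh h_top].
  have [_] := chain_lt C_chain lt_gh; rewrite CgN; case.
  by move=> u Chu; exists h.
by move=> u; suff : N u by []; rewrite -CgN g_top (chain_top C_chain).
Qed.

Context (kappa : {linear U -> U} -> A).
Context (kappaE : forall f : {linear U -> U}, kernel f = C (kappa f)).

Lemma kappa_lt_top f : (kappa f < \top)%O <-> exists u, f u <> 0.
Proof.
split=> [lt_top|[u fu]].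
  apply: contrapT => f0; have := chain_lt C_chain lt_top.
  rewrite -kappaE (chain_top C_chain) => -[_]; apply=> u _.
  by apply: contrapT => fu; apply: f0; exists u.
rewrite lt_neqAle lex1 andbT; apply/eqP => ktop; apply: fu.
suff : kernel f u by [].
by rewrite kappaE ktop (chain_top C_chain).
Qed.

(** Kernels far up the chain contain any given element, because the proper
   members of the chain exhaust [U]; and a kernel containing an element outside
   [C g] lies strictly above [C g], because kernels belong to the chain. *)
Lemma exhausts_kappa (f : nat -> {linear U -> U}) :
  exhausts (ordset \top%O) (kappa \o f) <->
  (forall n, exists u, f n u <> 0) /\
  (forall u, exists N, forall n, (N <= n)%N -> f n u = 0).
Proof.
split=> [[k_top k_lim]|[fn0 fsmall]].
  split=> [n|u]; first exact/kappa_lt_top/k_top.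
  have [g /k_lim[N gN] Cgu] : exists2 g, (g < \top)%O & C g u.
    have bot_top : (\bot < \top :> A)%O := le_lt_trans (le0x _) (k_top 0%N).
    apply: chain_limit bot_top _ u => g /k_lim[N gN]; exists (kappa (f N)); first exact: gN.
    exact: k_top.
  exists N => n /gN /ltW /chain_le /(_ u Cgu).
  by rewrite -kappaE.
split=> [n|g g_top]; first exact/kappa_lt_top.
have [_ /existsNP[u]] := chain_lt C_chain g_top.
rewrite (chain_top C_chain) => /not_implyP[_ nCgu].
have [N fN] := fsmall u; exists N => n /fN fnu.
rewrite ltNge; apply/negP => /chain_le; rewrite -kappaE => /(_ u fnu).
exact: nCgu.
Qed.
End Chain.

(** * Self-smallness *)

Theorem proposition4p4
  (R : pzRingType) (U : rmodType R)
  (U_neq0 : exists u : U, u <> 0)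
  (U_artinian : artinian U) (U_uniserial : uniserial U)
  (* A = alpha+1 and alpha = \top; C g = U_g *)
  (d : Order.disp_t) (A : tbOrderType d) (A_wo : well_ordered A)
  (C : A -> set U) (C_chain : submodule_chain C)
  (kappa : {linear U -> U} -> A)
  (kappaE : forall f : {linear U -> U}, kernel f = C (kappa f))
  (theta : A)
  (thetaE : order_isomorphic (range kappa) (ordset_succ theta)) :
  ~ self_small U <->
    cofinal (kappa @` [set f : {linear U -> U} | (f : U -> U) <> (fun=> 0)]) (ordset (\top%O : A)) /\
    has_cofinality (ordset theta) [set: nat].
Proof.
have kappa_nz : kappa @` [set f : {linear U -> U} | (f : U -> U) <> (fun=> 0)] =
    range kappa `&` ordset \top%O.
  apply/seteqP; split=> [_ [f fn0 <-]|_ [[f _ <-] f_top]].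
    split; first by exists f.
    apply/(kappa_lt_top C_chain kappaE); apply: contrapT => f0; apply: fn0.
    by apply/funext => u; apply: contrapT => fu; apply: f0; exists u.
  exists f => //= f0.
  by have [u []] := (kappa_lt_top C_chain kappaE f).1 f_top; rewrite f0.
(* kappa 0 is the top of the chain, and it belongs to the range of kappa. *)
have Kiso : order_isomorphic (range kappa `&` ordset \top%O) (ordset theta).
  apply: iso_remove_top thetaE => [|y _]; last exact: lex1.
  exists \0 => //; apply: (chain_inj C_chain).
  by rewrite -kappaE (chain_top C_chain); apply/seteqP; split.
have K_top : range kappa `&` ordset \top%O `<=` ordset \top%O by apply: subIsetr.
rewrite kappa_nz has_cofinality_natP -(exhausts_iso Kiso) not_self_smallP.
split=> [[f /(exhausts_kappa C_chain kappaE) f_ex]|[K_cof [z z_ex]]].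
  have kappa_f n : (range kappa `&` ordset \top%O) ((kappa \o f) n).
    by split; [exists (f n)|exact: f_ex.1].
  have [] := (exhausts_cofinal K_top kappa_f).1 f_ex.
  by split=> //; exists (kappa \o f).
have /choice[f fz] n : exists f, kappa f = z n.
  by have [[f _ <-] _] := z_ex.1 n; exists f.
have {}fz : kappa \o f = z by apply/funext.
exists f; apply/(exhausts_kappa C_chain kappaE); rewrite fz.
by apply/(exhausts_cofinal K_top z_ex.1).
Qed.
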